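(* Let $\Gamma = (I,(A_i)_{i\in I},(u_i)_{i\in I})$ be a game in normal form. Let $\mathcal{E}^n$ and $\mathcal{E}^{\tilde n}$ be the classes of all nested and of all GKZ elimination sequences of $\Gamma$, and let $\mathbf{\hat{R}}^n$ and $\mathbf{\hat{R}}^{\tilde n}$ be the sets of all maximal reductions of the sequences in $\mathcal{E}^n$ and $\mathcal{E}^{\tilde n}$, respectively. Then $\mathcal{E}^{\tilde{n}} \subseteq \mathcal{E}^{n}$ and $\mathbf{\hat{R}}^{\tilde{n}} = \mathbf{\hat{R}}^{n}$. Furthermore, the following statements are equivalent: 1) the class of GKZ elimination sequences $\mathcal{E}^{\tilde{n}}$ is locally bounded; 2) the class of nested elimination sequences $\mathcal{E}^n$ is locally bounded; 3) $\mathcal{E}^{\tilde{n}} = \mathcal{E}^n$.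
   Context: Game. $I$ is a set of players with at least two elements (otherwise of arbitrary cardinality); each $A_i$ is a non-empty set (of arbitrary cardinality) of pure strategies; $A=\prod_{j\in I}A_j$; $u_i:A\to\mathbb{R}$ is player $i$'s payoff function. No topological or measurability assumptions are made. Reductions. A reduction is a subset $R\subseteq A$ of the form $R=\prod_{i\in I}R_i$ with $R_i\subseteq A_i$ (possibly empty). Write $R_{-i}=\prod_{j\neq i}R_j$. Reductions are compared as subsets of $A$. For non-empty $R$ the factors $R_i$ are uniquely determined; all products with an empty factor are the same reduction $\emptyset$, and a relation $R\to\emptyset$ below is understood to hold if it holds for some choice of factors representing $\emptyset$. Strict dominance. For non-empty $R_{-i}$ and $a_i,b_i\in A_i$, write $a_i\prec_{R_{-i}}b_i$ ($a_i$ is strictly dominated by $b_i$ relative to $R_{-i}$) if $u_i(a_i,a_{-i})<u_i(b_i,a_{-i})$ for all $a_{-i}\in R_{-i}$. Dominance is defined only relative to non-empty $R_{-i}$; hence conditions about dominance impose nothing when $R=\emptyset$ (in particular $\emptyset\to S$ holds only for $S=\emptyset$). For reductions $R,S$: - $R\xrightarrow{n}S$ ($S$ is a nested reduction of $R$) if $S\subseteq R$ and for all $i\in I$: if $a_i\in R_i\setminus S_i$, then there is $b_i\in R_i$ with $a_i\prec_{R_{-i}}b_i$. - $R\xrightarrow{\tilde n}S$ ($S$ is a Gilboa-Kalai-Zemel (GKZ) reduction of $R$) if $S\subseteq R$ and for all $i\in I$: if $a_i\in R_i\setminus S_i$, then there is $b_i\in S_i$ with $a_i\prec_{R_{-i}}b_i$.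 Elimination sequences. For $\ell\in\{n,\tilde n\}$, an elimination sequence of type $\ell$ (nested if $\ell=n$, GKZ if $\ell=\tilde n$) is an ordinal-indexed sequence of reductions $\langle R^\alpha:\alpha<\delta\rangle$, with $\delta$ any non-zero ordinal, such that: $R^0=A$; $R^\alpha\xrightarrow{\ell}R^{\alpha+1}$ whenever $\alpha+1<\delta$; $R^\lambda=\bigcap_{\alpha<\lambda}R^\alpha$ for all limit ordinals $\lambda<\delta$; and there is a reduction $\hat R$ such that $R^\alpha=\hat R$ for some $\alpha<\delta$ and, for every reduction $S$, $\hat R\xrightarrow{\ell}S$ only if $S=\hat R$. This $\hat R$ is the maximal reduction of the sequence. The range of the sequence is $\{R^\alpha:\alpha<\delta\}$; the range of a class of elimination sequences is the set of all reductions belonging to the range of some sequence in the class. Local boundedness. A reduction $R$ is locally bounded if for all $i\in I$ and all $a_i\in R_i$: if $a_i\prec_{R_{-i}}b_i$ for some $b_i\in R_i$, then there is $c_i^*\in R_i$ such that $a_i\prec_{R_{-i}}c_i^*$ and there is no $c_i\in R_i$ with $c_i^*\prec_{R_{-i}}c_i$. A class of elimination sequences is locally bounded if every reduction in its range is locally bounded. *)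

(* Defs.v *)
From mathcomp Require Import all_boot all_order all_algebra.
From mathcomp Require Import boolp classical_sets reals.
From mathcomp Require wochoice.

Set Implicit Arguments.
Unset Strict Implicit.
Unset Printing Implicit Defensive.

Import Order.TTheory GRing.Theory Num.Theory.
Local Open Scope classical_set_scope.
Local Open Scope ring_scope.

Section Profiles.
Variables (I : Type) (A : I -> Type).

Definition profile : Type := forall i, A i.

Definition opp_profile (i : I) : Type := forall j, i <> j -> A j.

(* The profile (a_i, a_{-i}). *)
Definition join_profile (i : I) (a : A i) (o : opp_profile i) : profile :=
  fun j => match pselect (i = j) with
           | left e => eq_rect i A a j e
           | right ne => o j ne
           end.

Definition factors : Type := forall i, set (A i).

Definition box (F : factors) : set profile := [set x | forall i, F i (x i)].

Definition opp_box (F : factors) (i : I) : set (opp_profile i) :=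
  [set o | forall j (ne : i <> j), F j (o j ne)].

Definition reduction (X : set profile) : Prop := exists F, X = box F.

End Profiles.

Arguments opp_box {I A} F i _.

Section Dominance.
Variables (R : realType) (I : Type) (A : I -> Type) (u : I -> profile A -> R).

(* [a] is strictly dominated by [b] relative to [Q]; false when [Q] is empty. *)
Definition dominated (i : I) (Q : set (opp_profile A i)) (a b : A i) : Prop :=
  Q !=set0 /\ forall o, Q o -> u i (join_profile a o) < u i (join_profile b o).

(* The factors of a non-empty reduction are unique, so the quantification over
   [F] and [G] matters only for the empty reduction, which may be represented
   by any factors one of which is empty. *)
Definition nested_step (X Y : set (profile A)) : Prop :=
  Y `<=` X /\
  exists F G : factors A,
    [/\ X = box F, Y = box G &
        forall i (a : A i), F i a -> ~ G i a ->
          exists b, F i b /\ dominated (opp_box F i) a b].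

Definition gkz_step (X Y : set (profile A)) : Prop :=
  Y `<=` X /\
  exists F G : factors A,
    [/\ X = box F, Y = box G &
        forall i (a : A i), F i a -> ~ G i a ->
          exists b, G i b /\ dominated (opp_box F i) a b].

(* For the empty reduction this holds for every choice of factors. *)
Definition locally_bounded (X : set (profile A)) : Prop :=
  forall F : factors A, X = box F ->
  forall i (a : A i), F i a ->
    (exists b, F i b /\ dominated (opp_box F i) a b) ->
    exists c, [/\ F i c, dominated (opp_box F i) a c &
                  ~ exists d, F i d /\ dominated (opp_box F i) c d].

End Dominance.

(* A sequence <x^alpha : alpha < delta>, delta a non-zero ordinal, is encoded as
   a family indexed by a non-empty type with a (reflexive) well-order; delta is
   the order type. *)
Record transfinite_seq (T : Type) : Type := TransfiniteSeq {
  idx : Type;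
  idx_le : rel idx;
  idx_wo : wochoice.well_order idx_le;
  idx_inhabited : inhabited idx;
  term :> idx -> T
}.

Section Positions.
Variables (T : Type) (s : transfinite_seq T).
Implicit Types a b c : idx s.

Definition before a b : Prop := ~~ idx_le b a.

Definition is_zero a : Prop := forall b, idx_le a b.

Definition is_succ a b : Prop :=
  before a b /\ forall c, before a c -> idx_le b c.

Definition is_limit b : Prop := ~ is_zero b /\ forall a, ~ is_succ a b.

End Positions.

(* Classes of sequences are plain predicates rather than [set]s: [set] is not
   universe polymorphic, and index types have to be allowed to live in the
   universe of [set (profile A)]. *)
Definition seq_class (I : Type) (A : I -> Type) : Type :=
  transfinite_seq (set (profile A)) -> Prop.

Section Elimination.
Variables (I : Type) (A : I -> Type).
Variable step : set (profile A) -> set (profile A) -> Prop.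

Definition maximal_reduction_of
    (s : transfinite_seq (set (profile A))) (X : set (profile A)) : Prop :=
  [/\ reduction X, exists a, s a = X &
      forall Y, reduction Y -> step X Y -> Y = X].

Record elimination_seq (s : transfinite_seq (set (profile A))) : Prop := {
  elim_reduction : forall a, reduction (s a);
  elim_zero : forall a, is_zero a -> s a = [set: profile A];
  elim_succ : forall a b, is_succ a b -> step (s a) (s b);
  elim_limit : forall b, is_limit b ->
    s b = [set x | forall a, before a b -> s a x];
  elim_maximal : exists X, maximal_reduction_of s X
}.

Definition maximal_reductions : set (set (profile A)) :=
  [set X | exists s, elimination_seq s /\ maximal_reduction_of s X].

End Elimination.

Section Classes.
Variables (R : realType) (I : Type) (A : I -> Type) (u : I -> profile A -> R).

Definition class_range (E : seq_class A) : set (set (profile A)) :=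
  [set X | exists s, E s /\ exists a, s a = X].

Definition class_locally_bounded (E : seq_class A) : Prop :=
  forall X, class_range E X -> locally_bounded u X.

Definition nested_seqs : seq_class A := elimination_seq (nested_step u).

Definition gkz_seqs : seq_class A := elimination_seq (gkz_step u).

Definition maximal_nested : set (set (profile A)) :=
  maximal_reductions (nested_step u).

Definition maximal_gkz : set (set (profile A)) :=
  maximal_reductions (gkz_step u).

End Classes.

(* Main.v *)
Require Import Defs.
From mathcomp Require Import all_boot all_order all_algebra.
From mathcomp Require Import boolp classical_sets reals.
From mathcomp Require wochoice.

Set Implicit Arguments.
Unset Strict Implicit.
Unset Printing Implicit Defensive.

Import Order.TTheory GRing.Theory Num.Theory.
Local Open Scope classical_set_scope.
Local Open Scope ring_scope.

(* A nested step [X -> Y] can be replaced by a transfinite descent of GKZ steps: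
   from an intermediate reduction [Z] that is upward closed in [X] with respect
   to dominance outside [Y], pick a profile [x] of [Z] not in [Y] and delete,
   for each player, the strategies of [X] outside [Y] that are below [x].
   Upward closure guarantees that [x] has a dominating strategy in [Z], which is
   not deleted, and it is preserved both by this deletion and by intersections.
   Hence every term of a nested sequence, and in particular its maximal
   reduction, occurs in a GKZ sequence.  Both kinds of sequence are produced by
   one construction: a set map [f] with [f X <= X], iterated transfinitely,
   yields the smallest family closed under [f] and intersections, and this
   family is well-ordered by reverse inclusion.
   If a term is not locally bounded at [a], deleting [a] with all its dominators
   is a nested step that is not a GKZ step. *)

(** * Transfinite iteration of a decreasing set map *)

Section Tower.
Variables (T : Type) (f : set T -> set T).
Hypothesis f_sub : forall X, f X `<=` X.

Inductive tower : set T -> Prop :=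
| tower_step X : tower X -> tower (f X)
| tower_bigcap (C : set (set T)) :
    (forall X, C X -> tower X) -> tower [set x | forall X, C X -> X x].

(** The extreme points of the Bourbaki-Witt argument: one application of [f] from strictly above
    never jumps past them. *)
Let extreme X := forall Y, tower Y -> X `<=` Y -> X <> Y -> X `<=` f Y.

Lemma extreme_comparable X Y :
  extreme X -> tower Y -> X `<=` Y \/ Y `<=` f X.
Proof.
move=> Xext; elim=> {Y} [Y tY [XY|YfX]|C tC IH].
- have [->|XneY] := pselect (X = Y); first by right.
  by left; apply: Xext.
- by right; apply: subset_trans YfX; apply: f_sub.
have [XC|/existsPNP[Y CY nXY]] := pselect (forall Y, C Y -> X `<=` Y).
  by left=> x Xx Y CY; apply: (XC _ CY).
by right; have [//|YfX] := IH _ CY => x /(_ Y CY)/YfX.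
Qed.

Lemma tower_extreme X : tower X -> extreme X.
Proof.
elim=> {X} [X tX Xext|C tC IH] Y tY XY XneY.
  have [XsubY|YfX] := extreme_comparable Xext tY; last first.
    by case: XneY; rewrite eqEsubset.
  have [->|XneY'] := pselect (X = Y); first exact: subset_refl.
  by move=> x /f_sub; apply: Xext.
have [YC|/existsPNP[Z CZ nYZ]] := pselect (forall Z, C Z -> Y `<=` Z).
  by case: XneY; rewrite eqEsubset; split=> // x Yx Z /YC; apply.
have [ZY|YfZ] := extreme_comparable (IH _ CZ) tY; last first.
  by case: nYZ; apply: subset_trans YfZ _; apply: f_sub.
have ZfY : Z `<=` f Y by apply: IH => // ZeY; apply: nYZ; rewrite ZeY.
by move=> x /(_ Z CZ)/ZfY.
Qed.

Lemma tower_comparable X Y : tower X -> tower Y -> X `<=` Y \/ Y `<=` f X.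
Proof. by move=> tX; apply: extreme_comparable; apply: tower_extreme. Qed.

(** From above a fixed point, neither [f] (by extremality) nor an intersection can get below it. *)
Lemma tower_fixpoint_least X Y : tower X -> tower Y -> f X = X -> X `<=` Y.
Proof.
move=> tX tY fX; elim: tY => {Y} [Y tY XY|C tC IH x Xx Y /IH]; last exact.
have [<-|XneY] := pselect (X = Y); first by rewrite fX.
exact: tower_extreme.
Qed.

Lemma tower_max (D : set (set T)) :
  (forall X, D X -> tower X) -> D !=set0 ->
  exists2 X, D X & forall Y, D Y -> Y `<=` X.
Proof.
move=> tD [Y0 DY0].
(* The least member of the tower that bounds [D] from above. *)
pose M := [set x | forall Z, (tower Z /\ forall Y, D Y -> Y `<=` Z) -> Z x].
have tM : tower M by apply: tower_bigcap => Z [].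
have ubM Y : D Y -> Y `<=` M by move=> DY x Yx Z [_ /(_ _ DY)]; apply.
have [DM|nDM] := pselect (D M); first by exists M.
(* If [M] is not in [D], comparability puts every member of [D] inside [f M], which is then again an
   upper bound. *)
have fM : f M = M.
  rewrite eqEsubset; split; first exact: f_sub.
  move=> x; apply; split; first exact: tower_step.
  move=> Y DY; have [MY|//] := tower_comparable tM (tD _ DY).
  by case: nDM; suff -> : M = Y by []; rewrite eqEsubset; split=> //; apply: ubM.
case: nDM; suff -> : M = Y0 by [].
rewrite eqEsubset; split; last exact: ubM.
exact: tower_fixpoint_least (tD _ DY0) fM.
Qed.

Definition tower_le : rel {X | tower X} :=
  fun X Y => `[< sval Y `<=` sval X >].

Lemma tower_leP X Y : tower_le X Y <-> sval Y `<=` sval X.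
Proof. by rewrite /tower_le; split=> [/asboolP|/asboolP]. Qed.

Lemma tower_val_inj (X Y : {X | tower X}) : sval X = sval Y -> X = Y.
Proof.
case: X Y => [X tX] [Y tY] /= XY; move: tX tY; rewrite XY => tX tY.
by rewrite (Prop_irrelevance tX tY).
Qed.

Lemma tower_wo : wochoice.well_order tower_le.
Proof.
apply: wochoice.antisymmetric_well_order => [X Y|D].
  move=> /andP[/tower_leP YX /tower_leP XY].
  by apply: tower_val_inj; rewrite eqEsubset.
move=> [X0 DX0].
have [||X [tX DX] ubX] := @tower_max [set X | exists tX, exist tower X tX \in D].
- by move=> X [].
- by case: X0 DX0 => X tX DX; exists X, tX.
exists (exist tower X tX); split=> // -[Y tY] DY; apply/tower_leP; apply: ubX.
by exists tY.
Qed.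

Lemma tower_inhabited : inhabited {X | tower X}.
Proof.
exact: inhabits (exist tower _ (@tower_bigcap set0 (fun X => False_ind _))).
Qed.

Definition tower_seq : transfinite_seq (set T) :=
  TransfiniteSeq tower_wo tower_inhabited sval.

Implicit Types a b c : idx tower_seq.

Lemma tower_before a b : before a b <-> ~ (tower_seq a `<=` tower_seq b).
Proof.
rewrite /before; split=> [/negP nba /tower_leP|nba] //.
by apply/negP=> /tower_leP.
Qed.

(** The empty class yields the first term, the full class the last one, and the class of terms not
    contained in [b] the limit at [b]. *)
Lemma tower_seq_bigcap (C : set (set T)) :
  exists a, tower_seq a = [set x | forall b, C (tower_seq b) -> tower_seq b x].
Proof.
have tC : tower [set x | forall X, (tower X /\ C X) -> X x].
  by apply: tower_bigcap => X [].
exists (exist tower _ tC); rewrite eqEsubset; split=> x /= Hx.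
  by move=> b Cb; apply: Hx; split=> //; case: b Cb.
by move=> X [tX CX]; apply: (Hx (exist tower X tX)).
Qed.

Lemma tower_seq_zero a : is_zero a -> tower_seq a = setT.
Proof.
move=> a0; rewrite eqEsubset; split=> // x _.
have [b bE] := tower_seq_bigcap set0; have /tower_leP/(_ x) := a0 b; apply.
by rewrite -[sval b]/(tower_seq b) bE.
Qed.

Lemma tower_seq_succ a b :
  is_succ a b -> tower_seq b = f (tower_seq a) /\ tower_seq b <> tower_seq a.
Proof.
move=> [/tower_before nab minb].
have neq : tower_seq b <> tower_seq a by move=> ba; apply: nab; rewrite ba.
split=> //; rewrite eqEsubset; split.
  by have [] := tower_comparable (svalP a) (svalP b).
apply/(tower_leP b (exist tower _ (tower_step (svalP a)))); apply: minb.
apply/tower_before => /= afa; apply: nab.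
apply: tower_fixpoint_least (svalP a) (svalP b) _.
by rewrite eqEsubset; split=> //; apply: f_sub.
Qed.

Lemma tower_seq_next a : f (tower_seq a) <> tower_seq a ->
  exists2 b, is_succ a b & tower_seq b = f (tower_seq a).
Proof.
move=> fa; exists (exist tower _ (tower_step (svalP a))) => //; split.
  apply/tower_before => /= afa; apply: fa.
  by rewrite eqEsubset; split=> //; apply: f_sub.
move=> c /tower_before nac; apply/tower_leP => /=.
by have [] := tower_comparable (svalP a) (svalP c).
Qed.

Lemma tower_seq_limit b : is_limit b ->
  tower_seq b = [set x | forall a, before a b -> tower_seq a x].
Proof.
move=> [_ nsucc].
have [a aE] := tower_seq_bigcap [set X | ~ (X `<=` tower_seq b)].
have -> : [set x | forall c, before c b -> tower_seq c x] = tower_seq a.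
  by rewrite aE eqEsubset; split=> x /= Hx c /tower_before; apply: Hx.
have ba : tower_seq b `<=` tower_seq a.
  rewrite aE => x bx c ncb.
  have [cb|] := tower_comparable (svalP c) (svalP b); first by case: ncb.
  by move=> /(_ _ bx); apply: f_sub.
(* If [a] were strictly above [b], its successor would be [b] itself: otherwise [f a] would be among
   the intersected sets, and [a] would lie inside [f a]. *)
rewrite eqEsubset; split=> //; apply: contrapT => nab.
have [//|bfa] := tower_comparable (svalP a) (svalP b).
have fa : f (tower_seq a) <> tower_seq a.
  by move=> fa; apply: nab; apply: tower_fixpoint_least (svalP a) (svalP b) fa.
have [c sc cE] := tower_seq_next fa.
suff cb : c = b by apply: (nsucc a); rewrite -cb.
apply: tower_val_inj; rewrite -[sval c]/(tower_seq c) cE.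
rewrite eqEsubset; split=> //; apply: contrapT => nfab.
apply: fa; rewrite eqEsubset; split; first exact: f_sub.
by rewrite {1}aE -cE => x; apply => cb; apply: nfab; rewrite -cE.
Qed.

End Tower.

(** * Well-ordered positions and transfinite induction *)

Section Positions.
Variables (T : Type) (s : transfinite_seq T).
Implicit Types a b c : idx s.

Lemma position_min (P : idx s -> Prop) :
  (exists a, P a) -> exists2 a, P a & forall b, P b -> idx_le a b.
Proof.
move=> [a Pa].
have [|b [[/asboolP Pb minb] _]] := @idx_wo _ s (fun b => `[< P b >]).
  by exists a; apply/asboolP.
by exists b => // c Pc; apply: minb; apply/asboolP.
Qed.

Lemma position_total a b : idx_le a b \/ idx_le b a.
Proof.
have [|c [->|->] minc] := @position_min (fun c => c = a \/ c = b).
- by exists a; left.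
- by left; apply: minc; right.
- by right; apply: minc; left.
Qed.

Lemma position_anti a b : idx_le a b -> idx_le b a -> a = b.
Proof.
move=> ab ba.
have lexx c : idx_le c c by have [] := position_total c c.
(* Both [a] and [b] are least in the pair they form, and a well-order has unique minima. *)
have [|z [_ zU]] := @idx_wo _ s (fun c => `[< c = a \/ c = b >]).
  by exists a; apply/asboolP; left.
rewrite -(zU a) ?(zU b) //; split.
- by apply/asboolP; right.
- by move=> c /asboolP[]->.
- by apply/asboolP; left.
- by move=> c /asboolP[]->.
Qed.

Lemma position_ltVge a b : before a b \/ idx_le b a.
Proof. by rewrite /before; case: (idx_le b a); [right|left]. Qed.

Lemma succ_unique a b c : is_succ a b -> is_succ a c -> b = c.
Proof.
move=> [ab minb] [ac minc].
by apply: position_anti; [apply: minb|apply: minc].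
Qed.

Lemma position_ind (P : idx s -> Prop) :
  (forall b, is_zero b -> P b) ->
  (forall a b, is_succ a b -> P a -> P b) ->
  (forall b, is_limit b -> (forall a, before a b -> P a) -> P b) ->
  forall b, P b.
Proof.
move=> P0 PS PL b; apply: contrapT => nPb.
have [|c nPc minc] := @position_min (fun c => ~ P c); first by exists b.
have Pc a : before a c -> P a.
  by move=> /negP ac; apply: contrapT => /minc.
apply: nPc; have [/P0//|nz] := pselect (is_zero c).
have [[a sa]|ns] := pselect (exists a, is_succ a c).
  by apply: (PS _ _ sa); apply: Pc; have [] := sa.
by apply: PL => //; split=> // a sa; apply: ns; exists a.
Qed.

End Positions.

(** * Profiles, boxes and their factors *)

Definition others (I : Type) (A : I -> Type) (x : profile A) i :
  opp_profile A i := fun j _ => x j.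
Arguments others {I A} x i j _.

Section Reductions.
Variables (I : Type) (A : I -> Type).
Implicit Types (F G : factors A) (X Y : set (profile A)) (x : profile A).

Lemma join_profile_same i (a : A i) (o : opp_profile A i) :
  join_profile a o i = a.
Proof.
rewrite /join_profile; case: pselect => // e.
by rewrite (Prop_irrelevance e erefl).
Qed.

Lemma join_profile_other i (a : A i) (o : opp_profile A i) j (ne : i <> j) :
  join_profile a o j = o j ne.
Proof.
rewrite /join_profile; case: pselect => [e|ne']; first by case: ne.
by rewrite (Prop_irrelevance ne ne').
Qed.

Lemma box_join F i (a : A i) o :
  F i a -> opp_box F i o -> box F (join_profile a o).
Proof.
move=> Fa Fo j; have [<-|ne] := pselect (i = j); first by rewrite join_profile_same.
by rewrite join_profile_other; apply: Fo.
Qed.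

Lemma box_others F i x : box F x -> opp_box F i (others x i).
Proof. by move=> Fx j ne; apply: Fx. Qed.

Lemma box_sub F G i : box F !=set0 -> box F `<=` box G -> F i `<=` G i.
Proof.
move=> [x Fx] FG a Fa.
have := FG _ (box_join Fa (@box_others _ i _ Fx)) i.
by rewrite join_profile_same.
Qed.

Lemma box_inj F G : box F !=set0 -> box F = box G -> F = G.
Proof.
move=> F0 FG; apply: functional_extensionality_dep => i.
rewrite eqEsubset; split; apply: box_sub => //.
- by rewrite FG; apply: subset_refl.
- by rewrite -FG.
- by rewrite FG; apply: subset_refl.
Qed.

Lemma reduction_bigcap (C : set (set (profile A))) :
  (forall X, C X -> reduction X) -> reduction [set x | forall X, C X -> X x].
Proof.
(* Ranging over every factor family whose box is in [C] avoids a choice of representatives. *)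
move=> redC; exists (fun i => [set c | forall F, C (box F) -> F i c]).
rewrite eqEsubset; split=> x /= Hx.
  by move=> i F CF; apply: (Hx _ CF).
by move=> X CX; have [F XF] := redC _ CX; subst X => i; apply: Hx.
Qed.

Lemma empty_factor G : ~ (box G !=set0) -> exists j, G j = set0.
Proof.
move=> G0; apply: contrapT => nG; apply: G0.
have ex j : exists c, G j c.
  apply: contrapT => nc; apply: nG; exists j; rewrite eqEsubset.
  by split=> // c Gc; apply: nc; exists c.
by exists (fun j => sval (cid (ex j))) => j; apply: (svalP (cid (ex j))).
Qed.

End Reductions.

(** * Elimination sequences that follow a preferred step *)

Section Descent.
Variables (I : Type) (A : I -> Type).
Variables (step next : set (profile A) -> set (profile A) -> Prop).
Variable inv : set (profile A) -> Prop.
Hypothesis inv_reduction : forall X, inv X -> reduction X.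
Hypothesis inv_bigcap : forall C : set (set (profile A)),
  (forall X, C X -> inv X) -> inv [set x | forall X, C X -> X x].
Hypothesis next_sub : forall X Y, next X Y -> Y `<=` X.
Hypothesis next_neq : forall X Y, next X Y -> Y <> X.
Hypothesis next_inv : forall X Y, inv X -> next X Y -> inv Y.
Hypothesis next_step : forall X Y, inv X -> next X Y -> step X Y.
Hypothesis next_total : forall X Y, inv X -> reduction Y -> step X Y -> Y <> X ->
  exists Z, next X Z.

(** The iterated map takes a chosen [next] step where one exists and stands still elsewhere; by
    [next_total] it stands still only where no proper [step] is left. *)
Lemma elimination_descent : exists s, [/\ elimination_seq step s, forall a, inv (s a),
  forall a Y, next (s a) Y -> exists2 b, is_succ a b & next (s a) (s b) &
  forall C : set (set (profile A)),
    exists a, s a = [set x | forall b, C (s b) -> s b x]].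
Proof.
have exf X : exists Y, next X Y \/ Y = X /\ forall Z, ~ next X Z.
  have [[Y XY]|nX] := pselect (exists Y, next X Y); first by exists Y; left.
  by exists X; right; split=> // Z XZ; apply: nX; exists Z.
have [f fP] := choice exf.
have f_sub X : f X `<=` X by case: (fP X) => [/next_sub//|[-> _] x].
have f_next X Y : next X Y -> next X (f X).
  by move=> XY; case: (fP X) => // -[_ /(_ Y)].
have f_moves X : f X <> X -> next X (f X) by case: (fP X) => // -[].
have tower_inv X : tower f X -> inv X.
  elim=> {X} [X _ iX|C _]; last exact: inv_bigcap.
  by case: (fP X) => [/(next_inv iX)|[->]].
pose s := tower_seq f_sub.
have s_inv a : inv (s a) by apply: tower_inv; apply: svalP a.
have s_next a Y : next (s a) Y -> exists2 b, is_succ a b & next (s a) (s b).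
  move=> /f_next fa; have [b ab bE] := tower_seq_next (next_neq fa).
  by exists b => //; rewrite bE.
exists s; split=> //; last exact: tower_seq_bigcap.
split.
- by move=> a; apply: inv_reduction.
- exact: tower_seq_zero.
- move=> a b /tower_seq_succ[-> ne]; apply: next_step => //.
  by apply: f_moves.
- exact: tower_seq_limit.
(* The intersection of all terms is a term; a [next] step from it would produce a term containing
   it. *)
have [a aE] := @tower_seq_bigcap _ _ f_sub setT.
exists (s a); split; [exact: inv_reduction|by exists a|].
move=> Y redY stepY; apply: contrapT => neY.
have [Z /s_next[b _ nab]] := next_total (s_inv a) redY stepY neY.
apply: (next_neq nab); rewrite eqEsubset; split; first exact: next_sub.
by move=> x; rewrite [s a]aE => /(_ b); apply.
Qed.

End Descent.

(** * Nested steps against GKZ steps *)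

Section Steps.
Variables (R : realType) (I : Type) (A : I -> Type) (u : I -> profile A -> R).
Implicit Types (F G : factors A) (X Y : set (profile A)) (x : profile A).

Lemma dominated_irr i (Q : set (opp_profile A i)) a : ~ dominated u Q a a.
Proof. by move=> [[o Qo] /(_ _ Qo)]; rewrite ltxx. Qed.

Lemma dominated_trans i (Q : set (opp_profile A i)) b a c :
  dominated u Q a b -> dominated u Q b c -> dominated u Q a c.
Proof.
move=> [Q0 ab] [_ bc]; split=> // o Qo.
by apply: lt_trans (ab _ Qo) (bc _ Qo).
Qed.

Lemma dominated_sub i (Q Q' : set (opp_profile A i)) a b :
  Q' !=set0 -> Q' `<=` Q -> dominated u Q a b -> dominated u Q' a b.
Proof. by move=> Q'0 QQ' [_ ab]; split=> // o /QQ'/ab. Qed.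

(** If [Y] were empty, some factor [G j] would be empty, yet the coordinate [x j] of a profile of
    [X] would need a dominator in it. *)
Lemma gkz_step_nonempty X Y : X !=set0 -> gkz_step u X Y -> Y !=set0.
Proof.
move=> X0 [YX [F [G [XF YG FG]]]]; apply: contrapT; rewrite YG => /empty_factor[j Gj].
have [x] := X0; rewrite XF => Fx.
have [|b [+ _]] := FG j (x j) (Fx j); first by rewrite Gj.
by rewrite Gj.
Qed.

Lemma gkz_nested_step X Y : gkz_step u X Y -> nested_step u X Y.
Proof.
move=> gXY; have [YX [F [G [XF YG FG]]]] := gXY.
split=> //; have [X0|X0] := pselect (X !=set0).
  exists F, G; split=> // i a Fa nGa; have [b [Gb ab]] := FG i a Fa nGa.
  exists b; split=> //; apply: box_sub Gb; rewrite -YG -?XF //.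
  exact: gkz_step_nonempty gXY.
(* For empty [X] the dominators in [G] may lie outside [F]; since [Y] is empty too, [F] represents
   both sides. *)
exists F, F; split=> //; rewrite -XF eqEsubset; split=> // x Xx.
by case: X0; exists x.
Qed.

(** Dominance is measured against the fixed [F], not against [X], so the property survives
    intersections. *)
Definition upward_closed F G (X : set (profile A)) := forall x i (b : A i),
  X x -> box F x -> ~ G i (x i) -> F i b -> dominated u (opp_box F i) (x i) b ->
  X (join_profile b (others x i)).

Lemma gkz_refine F G X :
  (forall i a, F i a -> ~ G i a ->
    exists b, F i b /\ dominated u (opp_box F i) a b) ->
  reduction X -> X `<=` box F -> box G `<=` X -> X <> box G ->
  upward_closed F G X ->
  exists Y, [/\ gkz_step u X Y, reduction Y, Y <> X, box G `<=` Y &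
                upward_closed F G Y].
Proof.
move=> FG [H XH] XF GX neXG Xup.
have [x [Xx nGx]] : exists x, X x /\ ~ box G x.
  apply: contrapT => nx; apply: neXG; rewrite eqEsubset; split=> // x Xx.
  by apply: contrapT => nGx; apply: nx; exists x.
have Hx : box H x by rewrite -XH.
have HF i : H i `<=` F i by apply: box_sub; [exists x|rewrite -XH].
(* Deleting what [x j] dominates along with [x j] is what preserves upward closure. *)
pose D j := [set c : A j | [/\ F j c, ~ G j c, ~ G j (x j) &
  c = x j \/ dominated u (opp_box F j) c (x j)]].
pose K := fun j => H j `\` D j.
have YE : box K = [set y | X y /\ forall j, ~ D j (y j)].
  rewrite XH eqEsubset; split=> y /= Ky.
    by split=> j; have [] := Ky j.
  by move=> j; split; [apply: Ky.1|apply: Ky.2].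
exists (box K); split.
- split; first by rewrite YE => y [].
  exists H, K; split=> // j c Hc nKc.
  have [Fc nGc nGxj cx] : D j c by apply: contrapT => nDc; apply: nKc.
  (* This [b] lies in [H] by upward closure, and it is not deleted because it dominates [x j]. *)
  have [b [Fb xb]] := FG j (x j) (HF _ _ (Hx j)) nGxj.
  have cb : dominated u (opp_box F j) c b.
    by case: cx => [->//|cx]; apply: dominated_trans cx xb.
  exists b; split; last first.
    apply: dominated_sub cb; first by exists (others x j); apply: box_others.
    by move=> o Ho k ne; apply: HF; apply: Ho.
  split.
    have := Xup x j b Xx (XF _ Xx) nGxj Fb xb.
    by rewrite XH => /(_ j); rewrite join_profile_same.
  move=> [_ _ _ [bx|bx]].
    by apply: (dominated_irr (a := x j)); rewrite -{2}bx; apply: xb.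
  by apply: dominated_irr (dominated_trans bx xb).
- by exists K.
- move=> KX; apply: nGx => j; apply: contrapT => nGxj.
  move: Xx; rewrite -KX => /(_ j) [_]; apply; split=> //; first exact: HF.
  by left.
- by move=> y Gy; rewrite YE; split; [apply: GX|move=> j [_ /(_ (Gy j))]].
(* Were [b] deleted, it would equal [x i] or be dominated by it, so [y i] would have been deleted as
   well. *)
- move=> y i b; rewrite YE => -[Xy nDy] Fy nGy Fb yb; split; first exact: Xup.
  move=> j; have [ij|ne] := pselect (i = j); last first.
    by rewrite join_profile_other; apply: nDy.
  subst j; rewrite join_profile_same => -[_ _ nGx' bx].
  apply: (nDy i); split=> //; right.
  by case: bx => [<-//|]; apply: dominated_trans.
Qed.

(** The box [X] is upward closed for its own factors, so [gkz_refine] applies to it. Hence both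
    relations have the same maximal reductions. *)
Lemma nested_step_gkz X Y : nested_step u X Y -> Y <> X ->
  exists Z, [/\ gkz_step u X Z, reduction Z & Z <> X].
Proof.
move=> [YX [F [G [XF YG FG]]]] neq.
have [|||||Z [XZ redZ neZ _ _]] := @gkz_refine F G X FG.
- by exists F.
- by rewrite XF.
- by rewrite -YG.
- by move=> XG; apply: neq; rewrite XG.
- by move=> x i b _ Fx _ Fb _; rewrite XF; apply: box_join.
by exists Z.
Qed.

Lemma gkz_maximal s X :
  maximal_reduction_of (gkz_step u) s X <->
  maximal_reduction_of (nested_step u) s X.
Proof.
split=> -[redX sX maxX]; split=> // Y redY XY.
  apply: contrapT => /(nested_step_gkz XY)[Z [XZ redZ neZ]].
  by apply: neZ; apply: maxX.
by apply: maxX => //; apply: gkz_nested_step.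
Qed.

Lemma gkz_seqs_nested s : gkz_seqs u s -> nested_seqs u s.
Proof.
move=> [red zero succ lim [X maxX]]; split=> //; last by exists X; apply/gkz_maximal.
by move=> a b /succ; apply: gkz_nested_step.
Qed.

End Steps.

(** * A GKZ descent to a given term of a nested sequence *)

Section Refinement.
Variables (R : realType) (I : Type) (A : I -> Type) (u : I -> profile A -> R).
Implicit Types (F G : factors A) (X Y : set (profile A)) (x : profile A).
Variable s : transfinite_seq (set (profile A)).
Hypothesis s_nested : nested_seqs u s.
Implicit Types a b c : idx s.

Lemma nested_decreasing a b : idx_le a b -> s b `<=` s a.
Proof.
elim/position_ind: b a => [b b0|b c bc IH|c cl _] a.
- by move=> ab; rewrite (position_anti ab (b0 a)).
- have [ac ab|] := position_ltVge a c; last first.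
    by move=> ca ac; rewrite (position_anti ac ca).
  have [cb _] := elim_succ s_nested bc.
  have ab' : idx_le a b.
    have [ba|//] := position_ltVge b a.
    by move/negP: ac; case; case: bc => _; apply.
  by move=> x /cb; apply: IH.
- have [ac _|ca ac] := position_ltVge a c.
    by rewrite (elim_limit s_nested cl) => x; apply.
  by rewrite (position_anti ac ca).
Qed.

Let step_factors (p : idx s * idx s) (FG : factors A * factors A) :=
  is_succ p.1 p.2 -> [/\ s p.1 = box FG.1, s p.2 = box FG.2 &
    forall i (c : A i), FG.1 i c -> ~ FG.2 i c ->
      exists d, FG.1 i d /\ dominated u (opp_box FG.1 i) c d].

Lemma step_factors_exist : exists fg, forall p, step_factors p (fg p).
Proof.
have ex p : exists FG, step_factors p FG.
  have [sp|ns] := pselect (is_succ p.1 p.2).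
    by have [_ [F [G FG]]] := elim_succ s_nested sp; exists (F, G).
  by exists (fun i => set0, fun i => set0) => /ns.
by have [fg fgP] := choice ex; exists fg.
Qed.

Let fg := sval (cid step_factors_exist).
Let fgP p : step_factors p (fg p) := svalP (cid step_factors_exist) p.

(* The factors of a step into the empty reduction are not unique, so one choice
   of factors for each step of [s] is fixed once and for all. *)
Definition refines X := [/\ reduction X, forall a, X `<=` s a \/ s a `<=` X &
  forall a b, is_succ a b -> upward_closed u (fg (a, b)).1 (fg (a, b)).2 X].

Lemma refines_bigcap (C : set (set (profile A))) :
  (forall X, C X -> refines X) -> refines [set x | forall X, C X -> X x].
Proof.
move=> rC; split.
- by apply: reduction_bigcap => X /rC[].
- move=> a; have [aC|/existsPNP[X CX naX]] := pselect (forall X, C X -> s a `<=` X).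
    by right=> x ax X CX; apply: aC ax.
  by left=> x /(_ _ CX); have [_ /(_ a)[|//] + _] := rC _ CX; apply.
- move=> a b ab x i c Xx Fx nGx Fc xc X CX.
  by have [_ _ /(_ _ _ ab)] := rC _ CX; apply => //; apply: Xx.
Qed.

Lemma refine_next X a : refines X -> s a `<=` X -> X <> s a ->
  exists Y, [/\ gkz_step u X Y, refines Y, Y <> X & s a `<=` Y].
Proof.
move=> [redX cmpX upX] aX neXa.
(* The first term not containing [X] is a successor, since containment passes to limits; [X] thus
   sits between two consecutive terms. *)
have [|c ncX minc] := @position_min _ s (fun c => ~ (X `<=` s c)).
  by exists a => Xa; apply: neXa; rewrite eqEsubset.
have Xbefore b : before b c -> X `<=` s b.
  by move=> /negP bc; apply: contrapT => /minc.
have [b bc] : exists b, is_succ b c.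
  apply: contrapT => nb; apply: ncX.
  have [c0|c0] := pselect (is_zero c); first by rewrite (elim_zero s_nested c0).
  rewrite (elim_limit s_nested); first by move=> x Xx b /Xbefore; apply.
  by split=> // b bc; apply: nb; exists b.
have Xb : X `<=` s b by apply: Xbefore; case: bc.
have cX : s c `<=` X by have [|] := cmpX c.
have ac : s a `<=` s c.
  apply: nested_decreasing; apply: minc => Xa.
  by apply: neXa; rewrite eqEsubset.
have [/= sb sc FG] := @fgP (b, c) bc.
have [||||Y [XY redY neY GY upY]] := gkz_refine FG redX; rewrite -?sb -?sc //.
- by move=> Xc; apply: ncX; rewrite Xc.
- exact: upX.
have YX : Y `<=` X by case: XY.
have cY : s c `<=` Y by rewrite sc.
exists Y; split=> //; last by move=> x /ac/cY.
split=> // d.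
  have [dc|cd] := position_ltVge d c; first by left=> x /YX; apply: Xbefore.
  by right=> x xd; apply: cY; apply: nested_decreasing xd.
(* Only the current step [b -> c] needs [upY]. The target of an earlier step contains [Y], so no
   profile of [Y] violates its factors; at a later step the new profile stays in [s d], which lies
   inside [Y]. *)
move=> e de x i m Yx Fx nGx Fm xm.
have [/= sd se _] := @fgP (d, e) de.
have [db|bd] := position_ltVge d b.
  case: nGx; suff : box (fg (d, e)).2 x by apply.
  by rewrite -se; apply: nested_decreasing (Xb _ (YX _ Yx)); case: de => _; apply.
have [bd'|db] := position_ltVge b d.
  apply: cY; apply: (@nested_decreasing c d); first by case: bc => _; apply.
  by rewrite sd; apply: box_join.
have dE := position_anti db bd; subst d.
have eE := succ_unique de bc; subst e.
exact: upY.
Qed.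

(** Refining GKZ steps lead down to [s a], where an arbitrary policy [next] takes over. GKZ steps as
    policy place [s a] in a GKZ sequence; nested steps allow a prescribed step out of [s a]. *)
Lemma through_nested_term a (step next : set (profile A) -> set (profile A) -> Prop) :
  (forall X Y, gkz_step u X Y -> step X Y) ->
  (forall X Y, step X Y -> Y `<=` X) ->
  (forall X Y, next X Y -> [/\ step X Y, reduction Y & Y <> X]) ->
  (forall X Y, step X Y -> reduction Y -> Y <> X -> exists Z, next X Z) ->
  exists t, elimination_seq step t /\ exists b : idx t, t b = s a /\
    forall Y, next (t b) Y -> exists2 c : idx t, is_succ b c & next (t b) (t c).
Proof.
move=> gkz_sub step_sub nextP next_ex.
pose inv X := reduction X /\ (X `<=` s a \/ refines X /\ s a `<=` X).
pose next' X Y := (X `<=` s a /\ next X Y) \/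
  [/\ ~ (X `<=` s a), gkz_step u X Y, refines Y, Y <> X & s a `<=` Y].
have next_sub X Y : next' X Y -> Y `<=` X.
  by move=> [[_ /nextP[/step_sub]]|[_ []]].
have [|||||||t [et tinv tnext tcap]] := @elimination_descent I A step next' inv.
- by move=> X [].
- move=> C iC; split; first by apply: reduction_bigcap => X /iC[].
  have [[X [CX Xa]]|nC] := pselect (exists X, C X /\ X `<=` s a).
    by left=> x /(_ _ CX); apply: Xa.
  have iC' X : C X -> refines X /\ s a `<=` X.
    by move=> CX; have [_ [Xa|//]] := iC _ CX; case: nC; exists X.
  right; split; first by apply: refines_bigcap => X /iC'[].
  by move=> x ax X /iC'[_]; apply.
- exact: next_sub.
- by move=> X Y [[_ /nextP[]]|[]].
- move=> X Y _ [[Xa XY]|[_ XY rY _ aY]].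
    have [_ redY _] := nextP _ _ XY; split=> //; left=> x Yx.
    by apply: (Xa x); apply: (next_sub X Y) => //; left.
  by split; [case: rY|right].
- by move=> X Y _ [[_ /nextP[]]|[_ /gkz_sub]].
- move=> X Y [_ iX] redY XY neY.
  have [Xa|nXa] := pselect (X `<=` s a).
    by have [Z XZ] := next_ex _ _ XY redY neY; exists Z; left.
  have [//|[rX aX]] := iX.
  have [|Z [XZ rZ neZ aZ]] := refine_next rX aX.
    by move=> XE; apply: nXa; rewrite XE.
  by exists Z; right.
exists t; split=> //.
(* The smallest term containing [s a]; if it were larger than [s a], a further refining step would
   still contain [s a]. *)
have [b bE] := tcap [set X | s a `<=` X].
have ab : s a `<=` t b by rewrite bE => x ax c; apply.
have ba : t b `<=` s a.
  apply: contrapT => nba; have [_ [//|[rb _]]] := tinv b.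
  have [|Z [bZ rZ neZ aZ]] := refine_next rb ab.
    by move=> E; apply: nba; rewrite E.
  have [|c _ [[//]|[_ bc _ nec ac]]] := tnext b Z; first by right.
  apply: nec; rewrite eqEsubset; split.
    exact: step_sub (gkz_sub _ _ bc).
  by move=> x; rewrite bE => /(_ c ac).
exists b; split; first by rewrite eqEsubset.
move=> Y bY; have [|c bc [[_ ?]|[]//]] := tnext b Y; first by left.
by exists c.
Qed.

End Refinement.

(** * Comparison of the two classes of sequences *)

Section Classes.
Variables (R : realType) (I : Type) (A : I -> Type) (u : I -> profile A -> R).
Implicit Types (F G : factors A) (X Y : set (profile A)) (x : profile A).

Lemma nested_term_gkz s a : nested_seqs u s ->
  exists2 t, gkz_seqs u t & exists b : idx t, t b = s a.
Proof.
move=> sn; pose next X Y := [/\ gkz_step u X Y, reduction Y & Y <> X].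
have [||||t [et [b [bE _]]]] := @through_nested_term R I A u s sn a (gkz_step u) next.
- by [].
- by move=> X Y [].
- by [].
- by move=> X Y XY redY neY; exists Y.
by exists t => //; exists b.
Qed.

Lemma maximal_gkz_nested : maximal_gkz u = maximal_nested u.
Proof.
rewrite eqEsubset; split=> X [s [es maxX]].
  by exists s; split; [apply: gkz_seqs_nested|apply/gkz_maximal].
have [redX [a aE] maxX'] := maxX.
have [t et [b bE]] := nested_term_gkz a es.
exists t; split=> //; apply/gkz_maximal; split=> //.
by exists b; rewrite bE.
Qed.

(** The undominated dominator given by local boundedness cannot be deleted, as its deletion would
    require a dominator. *)
Lemma locally_bounded_gkz_step X Y :
  locally_bounded u X -> nested_step u X Y -> gkz_step u X Y.
Proof.
move=> lbX [YX [F [G [XF YG FG]]]]; split=> //; exists F, G; split=> // i a Fa nGa.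
have [c [Fc ac nc]] := lbX F XF i a Fa (FG i a Fa nGa).
exists c; split=> //; apply: contrapT => nGc.
by apply: nc; apply: FG.
Qed.

Lemma locally_bounded_nested_gkz :
  class_locally_bounded u (nested_seqs u) -> gkz_seqs u = nested_seqs u.
Proof.
move=> lb; apply/funext => s; apply/propext; split; first exact: gkz_seqs_nested.
move=> sn; have [red zero succ lim [X maxX]] := sn.
split=> //; last by exists X; apply/gkz_maximal.
move=> a b ab; apply: locally_bounded_gkz_step (succ _ _ ab).
by apply: lb; exists s; split=> //; exists a.
Qed.

Lemma class_locally_bounded_gkz_nested :
  class_locally_bounded u (gkz_seqs u) <->
  class_locally_bounded u (nested_seqs u).
Proof.
split=> lb X [s [sn [a aE]]]; apply: lb; last first.
  by exists s; split; [apply: gkz_seqs_nested|exists a].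
have [t et [b bE]] := nested_term_gkz a sn.
by exists t; split=> //; exists b; rewrite bE.
Qed.

Lemma not_locally_bounded_step X : ~ locally_bounded u X ->
  exists Y, [/\ nested_step u X Y, reduction Y, Y <> X & ~ gkz_step u X Y].
Proof.
move=> /existsNP[F /not_implyP[XF /existsNP[i /existsNP[a /not_implyP[Fa]]]]].
move=> /not_implyP[[b [Fb ab]] nlb].
pose D := [set c | c = a \/ dominated u (opp_box F i) a c].
(* Only player [i] loses strategies; the transport along [ij] brings [c] back to [A i]. *)
pose G j := [set c | F j c /\ forall ij : i = j, ~ D (eq_rect_r A c ij)].
have FG j : G j `<=` F j by move=> c [].
have GiD c : G i c -> ~ D c by move=> [_ /(_ erefl)].
have [o Fo] : opp_box F i !=set0 by case: ab.
have Fao : box F (join_profile a o) by apply: box_join.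
have F0 : box F !=set0 by exists (join_profile a o).
(* Failure of local boundedness at [a] means that every dominator of [a] in [F i] is itself
   dominated. *)
have elim_dom c : F i c -> D c ->
    exists d, F i d /\ dominated u (opp_box F i) c d.
  move=> Fc [->|ac]; first by exists b.
  by apply: contrapT => nd; apply: nlb; exists c.
exists (box G); split.
- split; first by rewrite XF => x Gx j; apply: FG.
  exists F, G; split=> // j c Fc nGc.
  have [ij Dc] : exists ij : i = j, D (eq_rect_r A c ij).
    apply: contrapT => nD; apply: nGc; split=> // ij Dc; apply: nD.
    by exists ij.
  by subst j; apply: elim_dom.
- by exists G.
- rewrite XF => GF; move: Fao; rewrite -GF => /(_ i)/GiD; apply.
  by rewrite join_profile_same; left.
(* Non-emptiness makes the factors unique, so a GKZ step would need a dominator of [a] in [G i],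
   where none is left. *)
- move=> gXY; have G0 : box G !=set0.
    by apply: gkz_step_nonempty gXY; rewrite XF.
  have [_ [F' [G' [XF' GG' FG']]]] := gXY.
  have FF' : F = F' by apply: box_inj => //; rewrite -XF.
  have GE : G = G' by apply: box_inj.
  subst F' G'.
  have [|c [Gc ac]] := FG' i a Fa; first by move=> /GiD; apply; left.
  by apply: (GiD c Gc); right.
Qed.

Lemma gkz_nested_locally_bounded :
  gkz_seqs u = nested_seqs u -> class_locally_bounded u (nested_seqs u).
Proof.
move=> gn X [s [sn [a aE]]]; apply: contrapT => /not_locally_bounded_step.
move=> [Y [XY redY neY nXY]].
(* At [X] the policy permits only the step to [Y]. The resulting nested sequence is GKZ by the
   equality of classes, which makes that step a GKZ step. *)
pose next Z W := [/\ nested_step u Z W, reduction W, W <> Z & Z = X -> W = Y].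
have [||||t [et [b [bE tnext]]]] :=
    @through_nested_term R I A u s sn a (nested_step u) next.
- exact: gkz_nested_step.
- by move=> Z W [].
- by move=> Z W [].
- move=> Z W ZW redW neW; have [->|ne] := pselect (Z = X).
    by exists Y.
  by exists W.
have [|c bc [_ _ _ cE]] := tnext Y; first by rewrite bE aE.
apply: nXY; move: et; rewrite -[elimination_seq _ _]/(nested_seqs u t) -gn => et.
by have := elim_succ et bc; rewrite cE bE aE.
Qed.

End Classes.

Theorem theorem3 (R : realType) (I : Type) (A : I -> Type)
    (u : I -> profile A -> R)
    (two_players : exists i j : I, i <> j)
    (strategies_nonempty : forall i, inhabited (A i)) :
  [/\ forall s, gkz_seqs u s -> nested_seqs u s,
      maximal_gkz u = maximal_nested u,
      class_locally_bounded u (gkz_seqs u) <->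
        class_locally_bounded u (nested_seqs u) &
      class_locally_bounded u (nested_seqs u) <->
        gkz_seqs u = nested_seqs u].
Proof.
split.
- exact: gkz_seqs_nested.
- exact: maximal_gkz_nested.
- exact: class_locally_bounded_gkz_nested.
- split; first exact: locally_bounded_nested_gkz.
  exact: gkz_nested_locally_bounded.
Qed.
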